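(* Let $n\geq 0$ be an integer. Then the summation formula for the higher order Horadam 3-parameter generalized quaternions is $$\sum_{r=0}^{n}\mathbf{Q}W_{r}(s)=\frac{(\alpha\beta)^{s}\,\mathbf{Q}W_{n}(s)-\mathbf{Q}W_{n+1}(s)+\sigma(s)\Pi}{(\alpha\beta)^{s}-(\alpha^{s}+\beta^{s})+1}-\Phi,$$ where $$\sigma(s)=W_{1}(s)+\left(1-(\alpha^{s}+\beta^{s})\right)W_{0}(s),\qquad \Pi=\mathbf{1}+\mathbf{i}+\mathbf{j}+\mathbf{k},$$ $$\Phi=W_{0}(s)\,\mathbf{i}+\left[W_{0}(s)+W_{1}(s)\right]\mathbf{j}+\left[(1-(\alpha\beta)^{s})W_{0}(s)+(1+\alpha^{s}+\beta^{s})W_{1}(s)\right]\mathbf{k}.$$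
   Context: Let $\alpha,\beta$ be distinct and nonzero real numbers, and let $W_n=\frac{1}{\alpha-\beta}\left[A\alpha^n-B\beta^n\right]$ be the $n$th Horadam number with initial values $W_0,W_1$, where $A=W_1-W_0\beta$ and $B=W_1-W_0\alpha$. Let $s\geq 1$ be a fixed integer. The higher order Horadam numbers are $W_n(s)=\frac{W_{sn}}{W_s}=\frac{1}{A\alpha^s-B\beta^s}\left[A\alpha^{sn}-B\beta^{sn}\right]$, $n\geq 0$; in particular $W_0(s)=\frac{W_0(\alpha-\beta)}{A\alpha^s-B\beta^s}$ and $W_1(s)=1$. A 3-parameter generalized quaternion, with parameters $\lambda_1,\lambda_2,\lambda_3$, is an element $x_0\mathbf{1}+x_1\mathbf{i}+x_2\mathbf{j}+x_3\mathbf{k}$ with $x_r\in\mathbb{R}$ ($r=0,1,2,3$), where the units multiply by the rules: $\mathbf{1}$ is the identity, $\mathbf{i}^2=-\lambda_1\lambda_2\mathbf{1}$, $\mathbf{j}^2=-\lambda_1\lambda_3\mathbf{1}$, $\mathbf{k}^2=-\lambda_2\lambda_3\mathbf{1}$, $\mathbf{i}\mathbf{j}=\lambda_1\mathbf{k}=-\mathbf{j}\mathbf{i}$, $\mathbf{j}\mathbf{k}=\lambda_3\mathbf{i}=-\mathbf{k}\mathbf{j}$, $\mathbf{k}\mathbf{i}=\lambda_2\mathbf{j}=-\mathbf{i}\mathbf{k}$. The higher order Horadam 3-parameter generalized quaternions are $\mathbf{Q}W_n(s)=W_n(s)\mathbf{1}+W_{n+1}(s)\mathbf{i}+W_{n+2}(s)\mathbf{j}+W_{n+3}(s)\mathbf{k}$,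 $n\geq 0$. *)

(* Defs.v *)
From HB Require Import structures.
From mathcomp Require Import all_boot all_order all_algebra.
From mathcomp Require Import reals ring.

Set Implicit Arguments.
Unset Strict Implicit.
Unset Printing Implicit Defensive.

Import GRing.Theory.
Local Open Scope ring_scope.

(* [GQuat l1 l2 l3 a b c d] is a 1 + b i + c j + d k.  The parameters l1, l2,
   l3 do not affect the carrier; they index the type so that each choice of
   parameters gets its own multiplication. *)
Record gquat (R : Type) (l1 l2 l3 : R) : Type :=
  GQuat { gq0 : R; gq1 : R; gq2 : R; gq3 : R }.

Section GQuatChoice.
Variables (R : Type) (l1 l2 l3 : R).

Definition gquat_tuple (x : gquat l1 l2 l3) : R * R * R * R :=
  let: GQuat a b c d := x in (a, b, c, d).

Definition tuple_gquat (t : R * R * R * R) : gquat l1 l2 l3 :=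
  let: (a, b, c, d) := t in GQuat l1 l2 l3 a b c d.

Lemma gquat_tupleK : cancel gquat_tuple tuple_gquat.
Proof. by case. Qed.

End GQuatChoice.

HB.instance Definition _ (R : eqType) (l1 l2 l3 : R) :=
  Equality.copy (gquat l1 l2 l3) (can_type (@gquat_tupleK R l1 l2 l3)).
HB.instance Definition _ (R : choiceType) (l1 l2 l3 : R) :=
  Choice.copy (gquat l1 l2 l3) (can_type (@gquat_tupleK R l1 l2 l3)).

Section GQuatAlgebra.
Variables (R : comNzRingType) (l1 l2 l3 : R).
Local Notation H := (gquat l1 l2 l3).
Local Notation Q := (GQuat l1 l2 l3).

Definition gq_add (x y : H) : H :=
  Q (gq0 x + gq0 y) (gq1 x + gq1 y) (gq2 x + gq2 y) (gq3 x + gq3 y).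

Definition gq_opp (x : H) : H := Q (- gq0 x) (- gq1 x) (- gq2 x) (- gq3 x).

Definition gq_scale (a : R) (x : H) : H :=
  Q (a * gq0 x) (a * gq1 x) (a * gq2 x) (a * gq3 x).

(* The bilinear extension of the multiplication table of the units, which is
   recovered in [mul_ii] ... [mul_ik] below. *)
Definition gq_mul (x y : H) : H :=
  let: GQuat a b c d := x in let: GQuat a' b' c' d' := y in
  Q (a * a' - l1 * l2 * (b * b') - l1 * l3 * (c * c') - l2 * l3 * (d * d'))
    (a * b' + b * a' + l3 * (c * d' - d * c'))
    (a * c' + c * a' + l2 * (d * b' - b * d'))
    (a * d' + d * a' + l1 * (b * c' - c * b')).

Fact gq_addA : associative gq_add.
Proof. by case=> ? ? ? ? [? ? ? ?] [? ? ? ?]; congr Q => /=; ring. Qed.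
Fact gq_addC : commutative gq_add.
Proof. by case=> ? ? ? ? [? ? ? ?]; congr Q => /=; ring. Qed.
Fact gq_add0 : left_id (Q 0 0 0 0) gq_add.
Proof. by case=> ? ? ? ?; congr Q => /=; ring. Qed.
Fact gq_addN : left_inverse (Q 0 0 0 0) gq_opp gq_add.
Proof. by case=> ? ? ? ?; congr Q => /=; ring. Qed.

HB.instance Definition _ :=
  GRing.isZmodule.Build H gq_addA gq_addC gq_add0 gq_addN.

Fact gq_mulA : associative gq_mul.
Proof. by case=> ? ? ? ? [? ? ? ?] [? ? ? ?]; congr Q => /=; ring. Qed.
Fact gq_mul1l : left_id (Q 1 0 0 0) gq_mul.
Proof. by case=> ? ? ? ?; congr Q => /=; ring. Qed.
Fact gq_mul1r : right_id (Q 1 0 0 0) gq_mul.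
Proof. by case=> ? ? ? ?; congr Q => /=; ring. Qed.
Fact gq_mulDl : left_distributive gq_mul gq_add.
Proof. by case=> ? ? ? ? [? ? ? ?] [? ? ? ?]; congr Q => /=; ring. Qed.
Fact gq_mulDr : right_distributive gq_mul gq_add.
Proof. by case=> ? ? ? ? [? ? ? ?] [? ? ? ?]; congr Q => /=; ring. Qed.
Fact gq_1neq0 : Q 1 0 0 0 != 0.
Proof. by apply/eqP => -[] /eqP; rewrite oner_eq0. Qed.

HB.instance Definition _ := GRing.Zmodule_isNzRing.Build H
  gq_mulA gq_mul1l gq_mul1r gq_mulDl gq_mulDr gq_1neq0.

Fact gq_scaleA a b x : gq_scale a (gq_scale b x) = gq_scale (a * b) x.
Proof. by congr Q => /=; ring. Qed.
Fact gq_scale1 : left_id 1 gq_scale.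
Proof. by case=> ? ? ? ?; congr Q => /=; ring. Qed.
Fact gq_scaleDr : right_distributive gq_scale +%R.
Proof. by move=> a x y; congr Q => /=; ring. Qed.
Fact gq_scaleDl x : {morph gq_scale^~ x : a b / a + b}.
Proof. by move=> a b; congr Q => /=; ring. Qed.

HB.instance Definition _ := GRing.Zmodule_isLmodule.Build R H
  gq_scaleA gq_scale1 gq_scaleDr gq_scaleDl.

Fact gq_scaleAl (a : R) (x y : H) : a *: (x * y) = a *: x * y.
Proof. by case: x y => ? ? ? ? [? ? ? ?]; congr Q => /=; ring. Qed.

HB.instance Definition _ := GRing.Lmodule_isLalgebra.Build R H gq_scaleAl.

Fact gq_scaleAr (a : R) (x y : H) : a *: (x * y) = x * (a *: y).
Proof. by case: x y => ? ? ? ? [? ? ? ?]; congr Q => /=; ring. Qed.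

HB.instance Definition _ := GRing.Lalgebra_isAlgebra.Build R H gq_scaleAr.

Definition qi : H := Q 0 1 0 0.
Definition qj : H := Q 0 0 1 0.
Definition qk : H := Q 0 0 0 1.

Lemma gquatE (a b c d : R) :
  Q a b c d = a *: (1 : H) + b *: qi + c *: qj + d *: qk.
Proof. by congr Q => /=; ring. Qed.

Lemma mul_ii : qi * qi = - (l1 * l2) *: (1 : H).
Proof. by congr Q => /=; ring. Qed.
Lemma mul_jj : qj * qj = - (l1 * l3) *: (1 : H).
Proof. by congr Q => /=; ring. Qed.
Lemma mul_kk : qk * qk = - (l2 * l3) *: (1 : H).
Proof. by congr Q => /=; ring. Qed.
Lemma mul_ij : qi * qj = l1 *: qk.
Proof. by congr Q => /=; ring. Qed.
Lemma mul_ji : qj * qi = - (l1 *: qk).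
Proof. by congr Q => /=; ring. Qed.
Lemma mul_jk : qj * qk = l3 *: qi.
Proof. by congr Q => /=; ring. Qed.
Lemma mul_kj : qk * qj = - (l3 *: qi).
Proof. by congr Q => /=; ring. Qed.
Lemma mul_ki : qk * qi = l2 *: qj.
Proof. by congr Q => /=; ring. Qed.
Lemma mul_ik : qi * qk = - (l2 *: qj).
Proof. by congr Q => /=; ring. Qed.

End GQuatAlgebra.

Section Horadam.
Variables (F : fieldType) (alpha beta w0 w1 : F).

Definition horadam (n : nat) : F :=
  let A := w1 - w0 * beta in
  let B := w1 - w0 * alpha in
  (alpha - beta)^-1 * (A * alpha ^+ n - B * beta ^+ n).

Lemma horadam0 : alpha != beta -> horadam 0 = w0.
Proof. by rewrite -subr_eq0 => ?; rewrite /horadam !expr0; field. Qed.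

Lemma horadam1 : alpha != beta -> horadam 1 = w1.
Proof. by rewrite -subr_eq0 => ?; rewrite /horadam !expr1; field. Qed.

Variable s : nat.

(* Meaningful when [horadam s != 0]. *)
Definition ho_horadam (n : nat) : F := horadam (s * n) / horadam s.

Lemma ho_horadam0 : alpha != beta -> ho_horadam 0 = w0 / horadam s.
Proof. by move=> ?; rewrite /ho_horadam muln0 horadam0. Qed.

Lemma ho_horadam1 : horadam s != 0 -> ho_horadam 1 = 1.
Proof. by move=> ?; rewrite /ho_horadam muln1 divff. Qed.

Variables l1 l2 l3 : F.

Definition ho_horadam_quat (n : nat) : gquat l1 l2 l3 :=
  ho_horadam n *: 1 + ho_horadam n.+1 *: qi l1 l2 l3
  + ho_horadam n.+2 *: qj l1 l2 l3 + ho_horadam n.+3 *: qk l1 l2 l3.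

Definition ho_sigma : F :=
  ho_horadam 1 + (1 - (alpha ^+ s + beta ^+ s)) * ho_horadam 0.

Definition gq_Pi : gquat l1 l2 l3 := 1 + qi l1 l2 l3 + qj l1 l2 l3 + qk l1 l2 l3.

Definition ho_Phi : gquat l1 l2 l3 :=
  ho_horadam 0 *: qi l1 l2 l3
  + (ho_horadam 0 + ho_horadam 1) *: qj l1 l2 l3
  + ((1 - (alpha * beta) ^+ s) * ho_horadam 0
     + (1 + alpha ^+ s + beta ^+ s) * ho_horadam 1) *: qk l1 l2 l3.

End Horadam.

(* Main.v *)
(** Both W_n(s) and QW_n(s) satisfy u_(n+2) = p u_(n+1) - q u_n with
    p = alpha^s + beta^s and q = (alpha beta)^s.  For such a sequence in any
    module the partial sums telescope after multiplication by q - p + 1; what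
    remains depends only on u_0 and u_1, and the constant Phi collects the
    initial terms lost when the sum is shifted in the i, j and k components. *)

Require Import Defs.
From mathcomp Require Import all_boot all_order all_algebra.
From mathcomp Require Import reals ring.

Import GRing.Theory.
Local Open Scope ring_scope.

Lemma sum_linear_recurrence (R : comNzRingType) (V : lmodType R) (p q : R)
    (u : nat -> V) (n : nat) :
  (forall m, u m.+2 = p *: u m.+1 - q *: u m) ->
  (q - p + 1) *: \sum_(0 <= r < n.+1) u r
    = q *: u n - u n.+1 + (u 1 + (1 - p) *: u 0).
Proof.
move=> urec; elim: n => [|n IHn].
  by rewrite big_nat1 addrA subrK -scalerDl addrA addrAC.
(* The recurrence turns the new term into a difference of consecutive values of q u_m - u_(m+1). *)
have step : (q - p + 1) *: u n.+1
    = (q *: u n.+1 - u n.+2) - (q *: u n - u n.+1).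
  rewrite urec !scalerDl scaleNr scale1r !opprB [q *: u n - p *: _]addrC.
  by rewrite !addrA [RHS]addrAC addrK.
by rewrite big_nat_recr //= scalerDr IHn step addrAC subrKC.
Qed.

(** [alpha ^+ s] and [beta ^+ s] are the roots of x^2 - p x + q; dividing by [horadam s] only
    rescales. *)
Lemma ho_horadam_rec (F : fieldType) (alpha beta w0 w1 : F) (s n : nat) :
  let W := ho_horadam alpha beta w0 w1 s in
  W n.+2 = (alpha ^+ s + beta ^+ s) * W n.+1 - (alpha * beta) ^+ s * W n.
Proof. by rewrite /= /ho_horadam /horadam !exprM !exprS exprMn; ring. Qed.

Lemma ho_horadam_quatE (F : fieldType) (alpha beta w0 w1 : F) (s : nat)
    (l1 l2 l3 : F) (n : nat) :
  let W := ho_horadam alpha beta w0 w1 s in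
  ho_horadam_quat alpha beta w0 w1 s l1 l2 l3 n
    = GQuat l1 l2 l3 (W n) (W n.+1) (W n.+2) (W n.+3).
Proof. by rewrite /= gquatE. Qed.

Lemma ho_horadam_quat_rec (F : fieldType) (alpha beta w0 w1 : F) (s : nat)
    (l1 l2 l3 : F) (n : nat) :
  let QW := ho_horadam_quat alpha beta w0 w1 s l1 l2 l3 in
  QW n.+2 = (alpha ^+ s + beta ^+ s) *: QW n.+1 - (alpha * beta) ^+ s *: QW n.
Proof. by rewrite /= !ho_horadam_quatE; congr GQuat; exact: ho_horadam_rec. Qed.

(** The i, j, k coefficients of [ho_Phi] are the partial sums W_0(s), W_0(s) + W_1(s) and W_0(s) +
    W_1(s) + W_2(s), with W_2(s) expanded by the recurrence. *)
Lemma ho_horadam_quat_initial (F : fieldType) (alpha beta w0 w1 : F) (s : nat)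
    (l1 l2 l3 : F) :
  let QW := ho_horadam_quat alpha beta w0 w1 s l1 l2 l3 in
  QW 1 + (1 - (alpha ^+ s + beta ^+ s)) *: QW 0
    = ho_sigma alpha beta w0 w1 s *: gq_Pi l1 l2 l3
      - ((alpha * beta) ^+ s - (alpha ^+ s + beta ^+ s) + 1)
        *: ho_Phi alpha beta w0 w1 s l1 l2 l3.
Proof.
(* Every component becomes a combination of W_0(s) and W_1(s), which [ring] can treat as free. *)
rewrite /= !ho_horadam_quatE !ho_horadam_rec /ho_sigma.
by congr GQuat => /=; ring.
Qed.

Theorem theorem4p1 (R : realType) (l1 l2 l3 : R) (alpha beta w0 w1 : R)
    (s n : nat)
    (alpha_neq_beta : alpha != beta) (alpha_neq0 : alpha != 0)
    (beta_neq0 : beta != 0) (s_ge1 : (1 <= s)%N)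
    (Ws_neq0 : horadam alpha beta w0 w1 s != 0)
    (den_neq0 : (alpha * beta) ^+ s - (alpha ^+ s + beta ^+ s) + 1 != 0) :
  let QW := ho_horadam_quat alpha beta w0 w1 s l1 l2 l3 in
  \sum_(0 <= r < n.+1) QW r =
    ((alpha * beta) ^+ s - (alpha ^+ s + beta ^+ s) + 1)^-1 *:
      ((alpha * beta) ^+ s *: QW n - QW n.+1
       + ho_sigma alpha beta w0 w1 s *: gq_Pi l1 l2 l3)
    - ho_Phi alpha beta w0 w1 s l1 l2 l3.
Proof.
move=> QW; apply: (scalerI den_neq0).
rewrite scalerBr scalerA divff // scale1r.
rewrite (sum_linear_recurrence _ _ _ _ _ _ (ho_horadam_quat_rec _ _ _ _ _ _ _ _ _)).
by rewrite ho_horadam_quat_initial addrA.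
Qed.
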